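(* Let $B_1,\dots,B_p$ be real $d\times d$ matrices with $B_i^T+B_i\le 0$ for $i=1,\dots,p$. Assume that for $r>0$ no connected component of the set $$\Big(\bigcup_{i=1}^p\mathcal{V}_i\Big)\cap S_r$$ intersects all the $\mathcal{V}_i$'s, $i=1,\dots,p$. Then for every regular input $u$ the matrix $S_u$ is equal to $0$, and the switched system $\dot x=B_{u(t)}x$ is asymptotically stable.
   Context: For a symmetric matrix $Q$, $Q\le 0$ means $x^TQx\le 0$ for all $x\in\mathbb{R}^d$; $\|\cdot\|$ is the Euclidean norm on $\mathbb{R}^d$ and $S_r=\{x\in\mathbb{R}^d;\ \|x\|=r\}$. For each $i$, $\mathcal{V}_i=\{x\in\mathbb{R}^d;\ \forall t\in\mathbb{R},\ \|e^{tB_i}x\|=\|x\|\}$, a linear subspace. An input (switching signal) is a piecewise constant, right-continuous function $u:[0,+\infty[\to\{1,\dots,p\}$, with switching times $(a_n)_{n\ge0}$, $a_0=0$, strictly increasing to $+\infty$; $u$ is constant, equal to $u_n$, on $[a_n,a_{n+1}[$, and $\delta_n=a_{n+1}-a_n$. The solution of $\dot x=B_{u(t)}x$ from $x$ is $t\mapsto\Phi_u(t)x$, where $\Phi_u(t)=\exp((t-a_n)B_{u_n})\exp(\delta_{n-1}B_{u_{n-1}})\cdots\exp(\delta_0B_{u_0})$ for $t\in[a_n,a_{n+1}[$. The matrix $\Phi_u(t)^T\Phi_u(t)$ converges as $t\to+\infty$, and $S_u$ denotes the symmetric nonnegative square root of its limit. The system is asymptotically stable for $u$ if $\Phi_u(t)x\to0$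 as $t\to+\infty$ for every $x\in\mathbb{R}^d$. The input $u$ is chaotic if there exist $\tau>0$ and a sequence of intervals $[t_k,t_k+\tau]$, $k\ge0$, with $t_k\to+\infty$, such that for all $\epsilon>0$ there exists $k_0$ such that for all $k\ge k_0$ the input $u$ is constant on no subinterval of $[t_k,t_k+\tau]$ of length greater than or equal to $\epsilon$. Otherwise $u$ is non chaotic. The input $u$ satisfies assumption $H(i)$ if there exist a subsequence $(a_{n_k})_{k\ge0}$ of the switching times and $\delta>0$ such that $u_{n_k}=i$ and $\delta_{n_k}\ge\delta$ for all $k\ge0$. The input $u$ is regular if it is non chaotic and satisfies $H(i)$ for every $i=1,\dots,p$. *)

(* Defs.v *)
From HB Require Import structures.
From mathcomp Require Import all_boot all_order all_algebra.
From mathcomp Require Import all_classical all_reals all_analysis.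

Set Implicit Arguments.
Unset Strict Implicit.
Unset Printing Implicit Defensive.

Import Order.TTheory GRing.Theory Num.Theory.
Import numFieldNormedType.Exports.

Local Open Scope classical_set_scope.
Local Open Scope ring_scope.

Definition norm2 (R : realType) d (x : 'cV[R]_d) : R :=
  Num.sqrt (\sum_(i < d) x i 0 ^+ 2).

Definition euclid_sphere (R : realType) (d : nat) (r : R) : set 'cV[R]_d :=
  [set x | norm2 x = r].

Definition negsemidef (R : realType) d (Q : 'M[R]_d) : Prop :=
  forall x : 'cV[R]_d, (x^T *m Q *m x) 0 0 <= 0.

Definition possemidef (R : realType) d (Q : 'M[R]_d) : Prop :=
  forall x : 'cV[R]_d, 0 <= (x^T *m Q *m x) 0 0.

(* The library topology on matrices is the entrywise one, which coincides with
   the Euclidean one; it is used for all limits and connected components. *)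
Definition expmx (R : realType) d (A : 'M[R]_d) : 'M[R]_d :=
  limn (series (fun k : nat => (k`!%:R)^-1 *: A ^+ k)).

Definition isoset (R : realType) d (A : 'M[R]_d) : set 'cV[R]_d :=
  [set x | forall t : R, norm2 (expmx (t *: A) *m x) = norm2 x].

(* [switch] is the sequence (a_n). Neither the values of [input_fun] at negative
   times nor a change of value at every a_n is constrained: an eventually
   constant signal is an input, cut at arbitrary times tending to +oo. *)
Record input (R : realType) (p : nat) := Input {
  input_fun :> R -> 'I_p;
  switch : nat -> R;
  switch0 : switch 0%N = 0;
  switch_incr : increasing_seq switch;
  switch_pinfty : switch n @[n --> \oo] --> +oo;
  input_piecewise : forall (n : nat) (t : R),
    switch n <= t < switch n.+1 -> input_fun t = input_fun (switch n) }.

Section Switched.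
Variables (R : realType) (d p : nat).
Implicit Types (B : 'I_p -> 'M[R]_d) (u : input R p).

Definition mode u (n : nat) : 'I_p := u (switch u n).

Definition duration u (n : nat) : R := switch u n.+1 - switch u n.

Fixpoint flow_switch B u (n : nat) : 'M[R]_d :=
  if n is m.+1 then expmx (duration u m *: B (mode u m)) *m flow_switch B u m
  else 1%:M.

(* The unique n with a_n <= t < a_(n+1) when 0 <= t; 0 by default if t < 0. *)
Definition switch_index u (t : R) : nat :=
  xget 0%N [set n | switch u n <= t < switch u n.+1].

Definition flow B u (t : R) : 'M[R]_d :=
  let n := switch_index u t in
  expmx ((t - switch u n) *: B (mode u n)) *m flow_switch B u n.

(* The default value is 1, not 0, so that for d > 0 the equation
   [limit_sqrt B u = 0] cannot hold merely because the limit fails to exist. *)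
Definition limit_sqrt B u : 'M[R]_d :=
  xget 1%:M [set S : 'M[R]_d | [/\ S^T = S, possemidef S &
    (flow B u t)^T *m flow B u t @[t --> +oo] --> S *m S]].

Definition asymptotically_stable B u : Prop :=
  forall x : 'cV[R]_d, flow B u t *m x @[t --> +oo] --> (0 : 'cV[R]_d).

Definition constant_on u (J : set R) : Prop :=
  exists i : 'I_p, forall s : R, J s -> u s = i.

(* The booleans b, b' range over the open and closed bounds. *)
Definition chaotic u : Prop :=
  exists2 tau : R, 0 < tau & exists t : nat -> R,
    [/\ forall k, 0 <= t k,
        t k @[k --> \oo] --> +oo &
        forall eps : R, 0 < eps -> exists k0 : nat,
          forall k : nat, (k0 <= k)%N ->
          forall (b b' : bool) (x y : R),
            let J := [set` Interval (BSide b x) (BSide b' y)] in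
            J `<=` `[t k, t k + tau] -> eps <= y - x -> ~ constant_on u J].

Definition H_assumption u (i : 'I_p) : Prop :=
  exists nk : nat -> nat, exists delta : R,
    [/\ {homo nk : m n / (m < n)%N}, 0 < delta &
        forall k : nat, mode u (nk k) = i /\ delta <= duration u (nk k)].

Definition regular_input u : Prop :=
  ~ chaotic u /\ forall i : 'I_p, H_assumption u i.

End Switched.

(* Main.v *)
Require Import Defs.
From HB Require Import structures.
From mathcomp Require Import all_boot all_order all_algebra.
From mathcomp Require Import all_classical all_reals all_analysis.
From mathcomp Require Import ring lra.

Set Implicit Arguments.
Unset Strict Implicit.
Unset Printing Implicit Defensive.

Import Order.TTheory GRing.Theory Num.Theory.
Import numFieldNormedType.Exports.

Local Open Scope classical_set_scope.
Local Open Scope ring_scope.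

(** Fix an initial vector x and let y(t) be the solution issued from it. Each
    mode is dissipative, so t |-> norm2 (y t) is nonincreasing and tends to some
    r >= 0; everything follows from r = 0.

    Suppose r > 0, and let Omega be the set of limit points of y at +oo. It lies
    on the sphere of radius r, is nonempty, and is connected because y is
    continuous with values in a compact set ([cluster_path_connected]). The
    contradiction with the hypothesis on components is that Omega is contained
    in the union of the isometric subspaces V_i and meets each of them.

    Both facts come from one observation ([omega_limit_isoset]): suppose that
    mode i is active on [s, s + e], with e > 0 fixed, for arbitrarily large s in
    a set S. Any limit point q of y along S satisfies
    norm2 (exp(tB_i) q) = r for all t in [0, e], since y (s + t) = exp(tB_i) y(s)
    has norm tending to r. Constancy of the norm on a nontrivial interval
    propagates to all times ([isoset_of_segment]), so q is in V_i.
    - H(i) provides such an S for every i, whence Omega meets V_i.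
    - If q in Omega were at positive distance from the closed union of the V_i, the
      Lipschitz bound on y would keep y near q on intervals [t_k, t_k + tau] of
      fixed length. The input not being chaotic, it is constant on
      subintervals of some fixed length for infinitely many k, with the same
      mode infinitely often, and this produces a point of some V_i near q
      ([omega_limit_sub_isosets]).

    Finally y -> 0 for every x forces the flow matrix, hence its Gram matrix,
    to tend to 0, and the only symmetric S with S S = 0 is 0. *)

(** * Entrywise limits of matrices *)

Lemma cvg_mx_entries (R : realType) (m n : nat) (T : Type)
    (F : set_system T) {FF : Filter F} (f : T -> 'M[R]_(m, n)) (l : 'M[R]_(m, n)) :
  (forall i j, f x i j @[x --> F] --> l i j) -> f x @[x --> F] --> l.
Proof.
move=> fl; apply/cvgrPdist_le => /= e e0; near=> x.
rewrite /Num.Def.normr/= mx_normrE (bigmax_le _ (ltW e0))//= => i _.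
rewrite !mxE/=; move: i; near: x; apply: filter_forall => /= i.
exact: ((cvgrPdist_le _ _).1 (fl i.1 i.2)).
Unshelve. all: by end_near. Qed.

Lemma cvg_entry (R : realType) (m n : nat) (T : Type)
    (F : set_system T) {FF : Filter F} (f : T -> 'M[R]_(m, n)) (l : 'M[R]_(m, n)) i j :
  f x @[x --> F] --> l -> f x i j @[x --> F] --> l i j.
Proof.
move=> fl; exact: (cvg_comp f (fun M : 'M[R]_(m, n) => M i j) fl
  (@coord_continuous _ _ _ i j l)).
Qed.

Lemma cvg_mulmx (R : realType) (m n k : nat) (T : Type)
    (F : set_system T) {FF : Filter F} (f : T -> 'M[R]_(m, n)) (g : T -> 'M[R]_(n, k))
    (a : 'M[R]_(m, n)) (b : 'M[R]_(n, k)) :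
  f x @[x --> F] --> a -> g x @[x --> F] --> b ->
  f x *m g x @[x --> F] --> a *m b.
Proof.
move=> fa gb; apply: cvg_mx_entries => i j; rewrite mxE.
under eq_fun do rewrite mxE.
apply: cvg_big => [|l _].
  exact: add_continuous.
by apply: cvgM; exact: cvg_entry.
Qed.

(** * The matrix exponential as an entrywise power series *)

Section MatrixExponential.
Variables (R : realType) (d : nat) (A : 'M[R]_d).

(** The entries of exp(tA) are the power series in t with coefficients
    [coef i j 0]. The shift m is there because formal differentiation turns
    [coef i j m] into [coef i j m.+1]: one convergence lemma then serves the
    series and its two derivatives. *)
Let coef (i j : 'I_d) (m k : nat) : R := (k`!%:R)^-1 * (A ^+ (k + m)) i j.

Lemma exprmx_entry_bound (i j : 'I_d) (k : nat) :
  `|(A ^+ k) i j| <= (\sum_l \sum_l' `|A l l'|) ^+ k.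
Proof.
elim: k i => [|k IH] i.
  by rewrite !expr0 mxE; case: (i == j); rewrite ?normr1// normr0.
rewrite exprS mxE (le_trans (ler_norm_sum _ _ _))// exprS.
apply: (@le_trans _ _ (\sum_l `|A i l| * (\sum_l \sum_l' `|A l l'|) ^+ k)).
  by apply: ler_sum => l _; rewrite normrM ler_wpM2l.
rewrite -mulr_suml ler_wpM2r//.
  by apply: exprn_ge0; apply: sumr_ge0 => l _; apply: sumr_ge0.
by rewrite [leRHS](bigD1 i)//= lerDl; apply: sumr_ge0 => l _; apply: sumr_ge0.
Qed.

(** Domination by M ^+ m times the exponential series of M |x|, where M is the
    sum of the absolute values of the entries of A. *)
Lemma is_cvg_coef i j m x : cvgn (pseries (coef i j m) x).
Proof.
set M := \sum_l \sum_l' `|A l l'|.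
have M0 : 0 <= M by apply: sumr_ge0 => l _; apply: sumr_ge0.
apply: normed_cvg.
apply: (@series_le_cvg _ _ (fun k => M ^+ m * exp_coeff (M * `|x|) k)) => [k|k|k|].
- exact: normr_ge0.
- by rewrite mulr_ge0// ?exprn_ge0// exp_coeff_ge0// mulr_ge0.
- rewrite /exp_coeff /= normrM normrM ger0_norm ?invr_ge0// normrX exprMn.
  rewrite [leRHS](_ : _ = k`!%:R^-1 * M ^+ (k + m) * `|x| ^+ k).
    rewrite ler_wpM2r ?exprn_ge0// ler_wpM2l ?invr_ge0//.
    exact: exprmx_entry_bound.
  by rewrite exprD; ring.
- exact: is_cvg_seriesZ (is_cvg_series_exp_coeff _).
Qed.

Lemma pseries_diffs_coef i j m : pseries_diffs (coef i j m) = coef i j m.+1.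
Proof.
apply/funext => k; rewrite /pseries_diffs /coef factS natrM invfM addnS addSn.
by rewrite mulrA mulVKf.
Qed.

Lemma exprmxZ (t : R) k : (t *: A) ^+ k = t ^+ k *: A ^+ k.
Proof.
elim: k => [|k IH]; first by rewrite !expr0 scale1r.
by rewrite !exprS IH -!mulmxE -scalemxAl -scalemxAr scalerA.
Qed.

Lemma expmx_term_entry t i j k :
  ((k`!%:R)^-1 *: (t *: A) ^+ k) i j = coef i j 0 k * t ^+ k.
Proof. by rewrite exprmxZ !mxE /coef addn0; ring. Qed.

(** The limit in [expmx] is the junk value of a divergent sequence unless
    convergence is known; entrywise it is [is_cvg_coef]. *)
Lemma expmx_cvg t :
  series (fun k => (k`!%:R)^-1 *: (t *: A) ^+ k) @ \oo --> expmx (t *: A).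
Proof.
suff h : series (fun k => (k`!%:R)^-1 *: (t *: A) ^+ k) @ \oo -->
    (\matrix_(i, j) limn (pseries (coef i j 0) t) : 'M[R]_d).
  by rewrite /expmx (cvg_lim _ h).
apply: cvg_mx_entries => i j; rewrite mxE.
rewrite (_ : (fun _ => _) = pseries (coef i j 0) t).
  exact: is_cvg_coef.
apply/funext => n; rewrite /pseries /series /= summxE.
by apply: eq_bigr => k _; exact: expmx_term_entry.
Qed.

Lemma expmx_entry t i j : expmx (t *: A) i j = limn (pseries (coef i j 0) t).
Proof.
apply/esym/cvg_lim => //.
rewrite (_ : pseries _ _ =
    (fun n => series (fun k => (k`!%:R)^-1 *: (t *: A) ^+ k) n i j)).
  apply: cvg_entry; exact: expmx_cvg.
apply/funext => n; rewrite /pseries /series /= summxE.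
by apply: eq_bigr => k _; rewrite expmx_term_entry.
Qed.

(** Rectangular N allows both N = A, which identifies the derivative of the
    exponential, and N = Q with Q A^k v = 0 for all k, which shows that
    Q exp(tA) v = 0. *)
Lemma mulmx_expmx_cvg (m : nat) (N : 'M[R]_(m, d)) t :
  series (fun k => (t ^+ k / k`!%:R) *: (N *m A ^+ k)) @ \oo --> N *m expmx (t *: A).
Proof.
rewrite (_ : series _ = fun n => N *m series (fun k => (k`!%:R)^-1 *: (t *: A) ^+ k) n).
  by apply: cvg_mulmx; [exact: cvg_cst|exact: expmx_cvg].
apply/funext => n; rewrite /series /= mulmx_sumr; apply: eq_bigr => k _.
by rewrite exprmxZ scalerA mulrC -scalemxAr.
Qed.

Lemma expmx_comm t : A *m expmx (t *: A) = expmx (t *: A) *m A.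
Proof.
have h1 := @mulmx_expmx_cvg _ A t.
rewrite -(cvg_lim (@norm_hausdorff _ _) h1); apply/cvg_lim => //.
rewrite (_ : series _ = fun n => series (fun k => (k`!%:R)^-1 *: (t *: A) ^+ k) n *m A).
  by apply: cvg_mulmx; [exact: expmx_cvg|exact: cvg_cst].
apply/funext => n; rewrite /series /= mulmx_suml; apply: eq_bigr => k _.
by rewrite exprmxZ scalerA mulrC -scalemxAl !mulmxE -exprS -exprSr.
Qed.

(** The formal derivative of the series of exp(tA) has the coefficients of
    A exp(tA); termwise differentiation is legitimate as the radius of
    convergence is infinite. *)
Lemma is_derive_expmx_entry t i j :
  is_derive t (1 : R) (fun s => expmx (s *: A) i j) ((A *m expmx (t *: A)) i j).
Proof.
rewrite (_ : (fun s => _) = (fun s => limn (pseries (coef i j 0) s))); last first.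
  by apply/funext => s; exact: expmx_entry.
have tK : `|t| < `|(`|t| + 1)| by rewrite [ltRHS]ger0_norm ?addr_ge0// ltrDl.
have dP : is_derive t (1 : R) (fun s => limn (pseries (coef i j 0) s))
    (limn (pseries (coef i j 1) t)).
  rewrite -pseries_diffs_coef; apply: pseries_snd_diffs tK;
    rewrite ?pseries_diffs_coef; exact: is_cvg_coef.
apply: is_derive_eq dP _.
apply/cvg_lim => //.
rewrite (_ : pseries _ _ =
    (fun n => series (fun k => (t ^+ k / k`!%:R) *: (A *m A ^+ k)) n i j)).
  apply: cvg_entry; exact: mulmx_expmx_cvg.
apply/funext => n; rewrite /pseries /series /= summxE.
by apply: eq_bigr => k _; rewrite !mxE /coef addn1 exprS !mxE; ring.
Qed.

Lemma expmx0 : expmx (0 *: A) = 1%:M :> 'M[R]_d.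
Proof.
apply/cvg_lim => //; rewrite -(cvg_shiftn 1)/=.
rewrite (_ : (fun n => _) = fun=> 1%:M); first exact: cvg_cst.
apply/funext => n; rewrite addn1 /series /= big_nat_recl//= big1 ?addr0.
  by rewrite expr0 invr1 scale1r.
by move=> k _; rewrite scale0r expr0n scaler0.
Qed.

End MatrixExponential.

(** * Derivatives of matrix-valued functions and the exponential flow *)

Definition is_mx_derive (R : realType) (m n : nat) (f : R -> 'M[R]_(m, n)) (t : R)
    (f' : 'M[R]_(m, n)) : Prop :=
  forall i j, is_derive t (1 : R) (fun s => f s i j) (f' i j).

Lemma is_mx_derive_cst (R : realType) (m n : nat) (N : 'M[R]_(m, n)) (t : R) :
  is_mx_derive (fun=> N) t 0.
Proof. by move=> i j; rewrite mxE; exact: is_derive_cst. Qed.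

Lemma is_mx_derive_mulmx (R : realType) (m n k : nat)
    (f : R -> 'M[R]_(m, n)) (g : R -> 'M[R]_(n, k)) (t : R) f' g' :
  is_mx_derive f t f' -> is_mx_derive g t g' ->
  is_mx_derive (fun s => f s *m g s) t (f t *m g' + f' *m g t).
Proof.
move=> ff gg i j.
rewrite (_ : (fun s => _) = \sum_l (fun s => f s i l * g s l j)); last first.
  by apply/funext => s; rewrite fct_sumE mxE.
have H l : is_derive t (1 : R) (fun s => f s i l * g s l j)
    (f t i l *: g' l j + g t l j *: f' i l).
  by have fl := ff i l; have gl := gg l j; exact: is_deriveM.
apply: is_derive_eq (is_derive_sum H) _.
rewrite !mxE -big_split/=; apply: eq_bigr => l _.
by rewrite /GRing.scale/= [X in _ + X]mulrC.
Qed.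

Lemma is_mx_derive_tr (R : realType) (m n : nat) (f : R -> 'M[R]_(m, n)) (t : R) f' :
  is_mx_derive f t f' -> is_mx_derive (fun s => (f s)^T) t f'^T.
Proof.
by move=> ff i j; rewrite mxE; under eq_fun do rewrite mxE; exact: ff.
Qed.

Lemma is_mx_derive0_cst (R : realType) (m n : nat) (f : R -> 'M[R]_(m, n)) s t :
  (forall r, is_mx_derive f r 0) -> f s = f t.
Proof.
move=> f0; apply/matrixP => i j.
by apply: (is_derive_0_is_cst (f := fun r => f r i j)) => r; have := f0 r i j; rewrite mxE.
Qed.

Section MatrixExponentialFlow.
Variables (R : realType) (d : nat) (A : 'M[R]_d).

Lemma is_mx_derive_expmx t :
  is_mx_derive (fun s => expmx (s *: A)) t (A *m expmx (t *: A)).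
Proof. by move=> i j; exact: is_derive_expmx_entry. Qed.

Lemma is_mx_derive_expmx_rev c t :
  is_mx_derive (fun s => expmx ((c - s) *: A)) t (- (A *m expmx ((c - t) *: A))).
Proof.
move=> i j.
have h := is_derive_expmx_entry A (c - t) i j.
apply: is_derive_eq (@is_derive1_comp _ (fun s => expmx (s *: A) i j)
  (fun s => c - s) t _ (- 1) h _) _.
  by apply: is_derive_eq (is_deriveB _ _) _; rewrite sub0r.
by rewrite mulrN1 !mxE.
Qed.

(** The derivative in r of exp((s+t-r)A) exp(rA) vanishes, A commuting with
    its exponential; compare r = 0 and r = t. *)
Lemma expmxD s t : expmx ((s + t) *: A) = expmx (s *: A) *m expmx (t *: A).
Proof.
have := @is_mx_derive0_cst R d d
  (fun r => expmx ((s + t - r) *: A) *m expmx (r *: A)) 0 t.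
rewrite subr0 expmx0 mulmx1 addrK; apply => r.
have := is_mx_derive_mulmx (is_mx_derive_expmx_rev (s + t) r) (is_mx_derive_expmx r).
by rewrite mulNmx mulmxA -expmx_comm subrr.
Qed.

Lemma is_mx_derive_expmx_mul (m n : nat) (N : 'M[R]_(m, d)) (v : 'M[R]_(d, n)) t :
  is_mx_derive (fun s => N *m (expmx (s *: A) *m v)) t
    (N *m A *m (expmx (t *: A) *m v)).
Proof.
have h1 := is_mx_derive_mulmx (is_mx_derive_expmx t) (is_mx_derive_cst v t).
have h2 := is_mx_derive_mulmx (is_mx_derive_cst N t) h1.
by move: h2; rewrite mulmx0 add0r mul0mx addr0 !mulmxA.
Qed.

(** The energy identity: along x' = Ax the squared norm has derivative
    x^T (A^T + A) x. *)
Lemma is_derive_sqnorm_expmx (v : 'cV[R]_d) t :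
  is_derive t (1 : R) (fun s => ((expmx (s *: A) *m v)^T *m (expmx (s *: A) *m v)) 0 0)
    (((expmx (t *: A) *m v)^T *m (A^T + A) *m (expmx (t *: A) *m v)) 0 0).
Proof.
have h1 := is_mx_derive_expmx_mul 1%:M v t.
have h2 := is_mx_derive_mulmx (is_mx_derive_tr h1) h1.
have := h2 0 0; under eq_fun do rewrite !mul1mx.
move=> h3; apply: (is_derive_eq h3).
move: (expmx (t *: A) *m v) => y.
by rewrite !mul1mx trmx_mul mulmxDr mulmxDl addrC !mulmxA.
Qed.

End MatrixExponentialFlow.

Lemma derivable_within_continuous1 (R : realType) (f df : R -> R) (D : set R) :
  (forall x : R, is_derive x (1 : R) f (df x)) -> {within D, continuous f}.
Proof.
move=> fd; apply: continuous_subspaceT => x.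
by apply/differentiable_continuous/derivable1_diffP; exact: (@ex_derive _ _ _ _ _ _ _ (fd x)).
Qed.

(** * The Euclidean norm *)

Lemma norm2E (R : realType) d (x : 'cV[R]_d) : norm2 x = Num.sqrt ((x^T *m x) 0 0).
Proof.
by rewrite /norm2 mxE; congr Num.sqrt; apply: eq_bigr => i _; rewrite mxE expr2.
Qed.

Lemma sqnorm_ge0 (R : realType) d (x : 'cV[R]_d) : 0 <= (x^T *m x) 0 0.
Proof. by rewrite mxE; apply: sumr_ge0 => i _; rewrite mxE -expr2 sqr_ge0. Qed.

Lemma norm2_ge0 (R : realType) d (x : 'cV[R]_d) : 0 <= norm2 x.
Proof. exact: sqrtr_ge0. Qed.

Lemma sqr_norm2 (R : realType) d (x : 'cV[R]_d) : norm2 x ^+ 2 = (x^T *m x) 0 0.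
Proof. by rewrite norm2E sqr_sqrtr// sqnorm_ge0. Qed.

Lemma entry_le_norm2 (R : realType) d (x : 'cV[R]_d) i : `|x i 0| <= norm2 x.
Proof.
rewrite -sqrtr_sqr ler_wsqrtr// (bigD1 i)//= lerDl.
by apply: sumr_ge0 => j _; exact: sqr_ge0.
Qed.

Lemma norm2_eq0 (R : realType) d (x : 'cV[R]_d) : norm2 x = 0 -> x = 0.
Proof.
move=> x0; apply/colP => i; rewrite mxE; apply/eqP; rewrite -normr_eq0 eq_le normr_ge0 andbT.
by rewrite -x0 entry_le_norm2.
Qed.

Lemma norm2_continuous (R : realType) d : continuous (@norm2 R d).
Proof.
move=> x; rewrite /continuous_at.
rewrite (_ : @norm2 R d = (fun y : 'cV[R]_d => Num.sqrt ((y^T *m y) 0 0))).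
  apply: (@cvg_comp _ _ _ (fun y : 'cV[R]_d => (y^T *m y) 0 0) Num.sqrt (nbhs x));
    last exact: sqrt_continuous.
  apply: (@cvg_entry _ _ _ _ _ _ (fun y : 'cV[R]_d => y^T *m y)).
  apply: cvg_mulmx; last exact: cvg_id.
  apply: cvg_mx_entries => i j; rewrite mxE; under eq_fun do rewrite mxE.
  by apply: cvg_entry; exact: cvg_id.
by apply/funext => y; exact: norm2E.
Qed.

Lemma mulmx_continuous (R : realType) (m n k : nat) (N : 'M[R]_(m, n)) :
  continuous (mulmx N : 'M[R]_(n, k) -> _).
Proof.
move=> x; apply: (@cvg_mulmx _ _ _ _ _ (nbhs x) _ (fun=> N) id).
  exact: cvg_cst.
exact: cvg_id.
Qed.

Lemma isoset_closed (R : realType) d (A : 'M[R]_d) : closed (isoset A).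
Proof.
rewrite (_ : isoset A = \bigcap_(t in setT)
  ((fun x => norm2 (expmx (t *: A) *m x) - norm2 x) @^-1` [set 0])).
  apply: closed_bigI => t _; apply: preimage_closed => //.
    move=> x _; apply: (@cvgB _ R^o _ (nbhs x)); last exact: norm2_continuous.
    apply: (@cvg_comp _ _ _ (mulmx (expmx (t *: A))) (@norm2 R d) (nbhs x));
      first exact: mulmx_continuous.
    exact: norm2_continuous.
  apply/seteqP; split => x /= h t; last by apply/eqP; rewrite -subr_eq0; apply/eqP/h.
  by move=> _ /=; rewrite h subrr.
Qed.

(** * Dissipative linear flows *)

(** At y the quadratic form reaches its maximum 0, so its gradient 2Qy
    vanishes there. *)
Lemma negsemidef_ker (R : realType) d (Q : 'M[R]_d) (y : 'cV[R]_d) :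
  negsemidef Q -> Q^T = Q -> (y^T *m Q *m y) 0 0 = 0 -> Q *m y = 0.
Proof.
move=> hQ sQ yQy; apply: norm2_eq0.
set z := Q *m y; set c := (z^T *m Q *m z) 0 0.
set a := (z^T *m z) 0 0.
have c0 : c <= 0 := hQ z.
have a0 : 0 <= a by exact: sqnorm_ge0.
(* With z = Qy, the form at (1 - c) y + a z is a^2 (2 - c), where c <= 0;
   being nonpositive, it forces a = 0. *)
have := hQ ((1 - c) *: y + a *: z).
have yQz : (y^T *m Q *m z) 0 0 = a by rewrite -{1}sQ -trmx_mul.
have zQy : (z^T *m Q *m y) 0 0 = a by rewrite -mulmxA.
rewrite [(_ + _)^T]linearD/= ![(_ *: _)^T]linearZ/= !mulmxDl !mulmxDr -!scalemxAl -!scalemxAr.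
rewrite ![fun_of_matrix (_ + _) _ _]mxE ![fun_of_matrix (_ *: _) _ _]mxE yQy yQz zQy -/c => h.
have aa : a ^+ 2 <= 0 by nra.
rewrite norm2E -/a; suff -> : a = 0 by rewrite sqrtr0.
by apply/eqP; rewrite -sqrf_eq0 eq_le aa sqr_ge0.
Qed.

Section DissipativeExponential.
Variables (R : realType) (d : nat) (A : 'M[R]_d).
Hypothesis hA : negsemidef (A^T + A).

Lemma norm2_expmx_le (v : 'cV[R]_d) t :
  0 <= t -> norm2 (expmx (t *: A) *m v) <= norm2 v.
Proof.
move=> t0; rewrite !norm2E ler_wsqrtr//.
have [c _] := MVT_segment t0 (fun x _ => is_derive_sqnorm_expmx A v x)
  (derivable_within_continuous1 (is_derive_sqnorm_expmx A v)).
rewrite expmx0 mul1mx => h; rewrite -subr_le0 h subr0 mulr_le0_ge0// hA.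
Qed.

(** Mean value inequality: the speed A exp(cA) v is bounded by the entries of
    A and the norm of v because the flow is contracting. *)
Lemma expmx_displacement (v : 'cV[R]_d) t : 0 <= t ->
  `|expmx (t *: A) *m v - v| <= t * ((\sum_l \sum_l' `|A l l'|) * norm2 v).
Proof.
move=> t0; set K := \sum_l _.
have K0 : 0 <= K by apply: sumr_ge0 => l _; apply: sumr_ge0.
have rowK i : \sum_l `|A i l| <= K.
  by rewrite /K [leRHS](bigD1 i)//= lerDl; apply: sumr_ge0 => l _; apply: sumr_ge0.
rewrite /Num.Def.normr/= mx_normrE bigmax_le//=.
  by rewrite !mulr_ge0// norm2_ge0.
case=> i j _ /=; rewrite (ord1 j) {j}.
have dv x : is_derive x (1 : R) (fun s => (expmx (s *: A) *m v) i 0)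
    ((A *m (expmx (x *: A) *m v)) i 0).
  have := is_mx_derive_expmx_mul A 1%:M v x i 0.
  by rewrite mul1mx; under eq_fun do rewrite mul1mx.
have [c ct] := MVT_segment t0 (fun x _ => dv x) (derivable_within_continuous1 dv).
rewrite expmx0 mul1mx subr0 => h.
rewrite mxE [X in _ + X]mxE h normrM (ger0_norm t0) mulrC ler_wpM2l//.
rewrite mxE (le_trans (ler_norm_sum _ _ _))//.
apply: (@le_trans _ _ (\sum_l `|A i l| * norm2 v)).
  apply: ler_sum => l _; rewrite normrM ler_wpM2l// (le_trans (entry_le_norm2 _ _))//.
  by apply: norm2_expmx_le; move: ct; rewrite in_itv/= => /andP[].
by rewrite -mulr_suml ler_wpM2r ?norm2_ge0// rowK.
Qed.

(** If the norm is constant on [0, e], the energy identity gives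
    Q exp(tA) v = 0 on ]0, e[ for Q = A^T + A. Differentiating repeatedly,
    Q A^k exp(tA) v = 0 for all k, which is the whole Taylor series of
    t |-> Q exp(tA) v at an interior point: this function vanishes for all t,
    and the energy identity gives back a constant norm on the whole line. *)
Lemma isoset_of_segment (v : 'cV[R]_d) e : 0 < e ->
  (forall t, 0 <= t <= e -> norm2 (expmx (t *: A) *m v) = norm2 v) ->
  isoset A v.
Proof.
move=> e0 hv; set Q := A^T + A.
have sQ : Q^T = Q by rewrite /Q linearD/= trmxK addrC.
have ker k t : 0 < t < e -> Q *m A ^+ k *m (expmx (t *: A) *m v) = 0.
  elim: k t => [|k IH] t /andP[t0 te].
    rewrite expr0 mulmx1; apply: negsemidef_ker => //.
    have := is_derive_sqnorm_expmx A v t; rewrite -/Q => dq.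
    have dc : is_derive t (1 : R) (fun s =>
        ((expmx (s *: A) *m v)^T *m (expmx (s *: A) *m v)) 0 0) 0.
      apply: (@near_eq_is_derive _ _ _ (cst (norm2 v ^+ 2))).
      near=> s; rewrite /= -sqr_norm2 hv//; apply/andP; split.
        by apply: ltW; near: s; exact: lt_nbhsr.
      by apply: ltW; near: s; exact: lt_nbhsl.
    by rewrite -(@derive_val _ _ _ _ _ _ _ dq) (@derive_val _ _ _ _ _ _ _ dc).
  apply/colP => i; rewrite [RHS]mxE exprSr -mulmxE (mulmxA Q).
  have dq := is_mx_derive_expmx_mul A (Q *m A ^+ k) v t i 0.
  have dc : is_derive t (1 : R) (fun s => (Q *m A ^+ k *m (expmx (s *: A) *m v)) i 0) 0.
    apply: (@near_eq_is_derive _ _ _ (cst 0)).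
    near=> s; rewrite IH ?mxE//; apply/andP; split.
      by near: s; exact: lt_nbhsr.
    by near: s; exact: lt_nbhsl.
  by rewrite -(@derive_val _ _ _ _ _ _ _ dq) (@derive_val _ _ _ _ _ _ _ dc).
(* Expansion at the interior point h of ]0, e[. *)
have Q0 t : Q *m (expmx (t *: A) *m v) = 0.
  pose h := e / 2; have he : 0 < h < e by rewrite /h; apply/andP; split; lra.
  rewrite -(subrK h t) expmxD -mulmxA.
  set w := expmx (h *: A) *m v; set s := t - h.
  suff -> : Q *m (expmx (s *: A) *m w) = 0 by [].
  have cv : series (fun k => (s ^+ k / k`!%:R) *: (Q *m A ^+ k)) n *m w @[n --> \oo]
      --> Q *m expmx (s *: A) *m w.
    by apply: cvg_mulmx; [exact: mulmx_expmx_cvg|exact: cvg_cst].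
  rewrite mulmxA -(cvg_lim (@norm_hausdorff _ _) cv); apply/cvg_lim => //.
  rewrite (_ : (fun _ => _) = fun=> 0); first exact: cvg_cst.
  apply/funext => n; rewrite /series/= mulmx_suml big1// => k _.
  by rewrite -scalemxAl ker// scaler0.
move=> t; rewrite !norm2E; congr Num.sqrt.
rewrite -[in RHS](mul1mx v) -(expmx0 A).
apply: (is_derive_0_is_cst
  (f := fun s => ((expmx (s *: A) *m v)^T *m (expmx (s *: A) *m v)) 0 0)).
move=> x; apply: is_derive_eq (is_derive_sqnorm_expmx A v x) _.
by rewrite -/Q -mulmxA Q0 mulmx0 mxE.
Unshelve. all: by end_near. Qed.

End DissipativeExponential.

(** * The flow of a switched system *)

Section SwitchingTimes.
Variables (R : realType) (p : nat) (u : input R p).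

Lemma switch_le m n : (switch u m <= switch u n) = (m <= n)%N.
Proof. exact: switch_incr. Qed.

Lemma switch_ge0 n : 0 <= switch u n.
Proof. by rewrite -(switch0 u) switch_le. Qed.

Lemma switch_unbounded t : exists n, t < switch u n.
Proof.
have /cvgryPgt/(_ t)[n _ h] := @switch_pinfty _ _ u.
by exists n; apply: h => /=.
Qed.

Lemma switch_index_eq n t : switch u n <= t < switch u n.+1 -> switch_index u t = n.
Proof.
move=> nt; rewrite /switch_index; apply: xget_unique => // m mt.
move: nt mt => /andP[nt tn] /andP[mt tm]; apply/eqP; rewrite eqn_leq.
have := le_lt_trans mt tn; have := le_lt_trans nt tm.
by rewrite !ltNge !switch_le -!ltnNge !ltnS => -> ->.
Qed.

Lemma switch_indexP t : 0 <= t ->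
  switch u (switch_index u t) <= t < switch u (switch_index u t).+1.
Proof.
move=> t0; have /ex_minnP[[|n] nt nmin] : exists n, t < switch u n.
- exact: switch_unbounded.
- by move: nt; rewrite switch0 ltNge t0.
have h : switch u n <= t < switch u n.+1.
  rewrite nt andbT leNgt; apply/negP => /nmin; by rewrite ltnn.
by rewrite (switch_index_eq h).
Qed.

Lemma mode_eq n s : switch u n <= s < switch u n.+1 -> u s = mode u n.
Proof. exact: input_piecewise. Qed.

(** A transitive relation between times that holds inside each piece
    [a_n, a_(n+1)] holds between any two nonnegative times. Pieces are closed on
    the right, which is what lets consecutive ones be chained. *)
Lemma pieces_ind (P : R -> R -> Prop) :
  (forall s r t, 0 <= s -> s <= r -> r <= t -> P s r -> P r t -> P s t) ->
  (forall n s t, switch u n <= s -> s <= t -> t <= switch u n.+1 -> P s t) ->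
  forall s t, 0 <= s -> s <= t -> P s t.
Proof.
move=> trP pieceP s t s0 st.
have /andP[ns sn] := switch_indexP s0; set n := switch_index u s in ns sn.
have H m t' : s <= t' -> t' <= switch u (n + m).+1 -> P s t'.
  elim: m t' => [|m IH] t' st' tm.
    by apply: (pieceP n) => //; rewrite -(addn0 n).
  have [|tm'] := leP t' (switch u (n + m).+1); first exact: IH.
  have snm : s <= switch u (n + m).+1.
    by rewrite (le_trans (ltW sn))// switch_le ltnS leq_addr.
  apply: (trP s (switch u (n + m).+1) t') => //.
  - exact: ltW.
  - exact: IH.
  - by apply: (pieceP (n + m).+1) => //; [exact: ltW|rewrite -addnS].
have [m tm] := switch_unbounded t.
by apply: (H m) => //; rewrite (le_trans (ltW tm))// switch_le leqW// leq_addl.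
Qed.

End SwitchingTimes.

Section Flow.
Variables (R : realType) (d p : nat) (B : 'I_p -> 'M[R]_d) (u : input R p).

(** At t = a_(n+1) the flow is computed from piece n+1, but continuity at
    switching times makes the formula of piece n valid there too. *)
Lemma flow_closed_piece n t : switch u n <= t <= switch u n.+1 ->
  flow B u t = expmx ((t - switch u n) *: B (mode u n)) *m flow_switch B u n.
Proof.
move=> /andP[nt]; rewrite le_eqVlt => /predU1P[->|tn]; last first.
  by rewrite /flow (@switch_index_eq _ _ _ n)// nt.
rewrite /flow (@switch_index_eq _ _ _ n.+1).
  by rewrite subrr expmx0 mul1mx.
by rewrite lexx/= ltNge switch_le ltnn.
Qed.

Lemma flow_piece n s t : switch u n <= s -> s <= t -> t <= switch u n.+1 ->
  flow B u t = expmx ((t - s) *: B (mode u n)) *m flow B u s.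
Proof.
move=> ns st tn; rewrite (@flow_closed_piece n t) ?(le_trans ns st)//.
rewrite (@flow_closed_piece n s) ?ns ?(le_trans st tn)//.
by rewrite mulmxA -expmxD addrA subrK.
Qed.

Lemma flow0 : flow B u 0 = 1%:M.
Proof.
rewrite (@flow_closed_piece 0); first by rewrite switch0 subrr expmx0 mul1mx.
by rewrite switch0 lexx/= switch_ge0.
Qed.

(** Switching times may fall inside ]s, t[ although the mode does not change
    there, so the exponentials of the pieces have to be glued. *)
Lemma flow_constant_mode i s t : 0 <= s -> s <= t ->
  (forall z, s <= z < t -> u z = i) ->
  flow B u t = expmx ((t - s) *: B i) *m flow B u s.
Proof.
apply: (@pieces_ind _ _ u (fun s t => (forall z, s <= z < t -> u z = i) ->
  flow B u t = expmx ((t - s) *: B i) *m flow B u s)).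
- move=> {}s r {}t _ sr rt sri rti ui.
  rewrite rti; last by move=> z /andP[rz zt]; apply: ui; rewrite (le_trans sr rz).
  rewrite sri; last by move=> z /andP[sz zr]; apply: ui; rewrite sz (lt_le_trans zr rt).
  by rewrite mulmxA -expmxD addrA subrK.
move=> n {}s {}t ns; rewrite le_eqVlt => /predU1P[<-|st] tn ui.
  by rewrite subrr expmx0 mul1mx.
rewrite (flow_piece ns (ltW st) tn) -(@mode_eq _ _ _ n s) ?ui ?lexx//.
by rewrite ns (lt_le_trans st tn).
Qed.

Hypothesis hB : forall i : 'I_p, negsemidef ((B i)^T + B i).
Variable x : 'cV[R]_d.

Lemma norm2_flow_nonincr s t : 0 <= s -> s <= t ->
  norm2 (flow B u t *m x) <= norm2 (flow B u s *m x).
Proof.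
apply: (@pieces_ind _ _ u (fun s t =>
  norm2 (flow B u t *m x) <= norm2 (flow B u s *m x))).
  by move=> {}s r {}t _ _ _ sr rt; exact: le_trans rt sr.
move=> n {}s {}t ns st tn; rewrite (flow_piece ns st tn) -mulmxA.
by apply: norm2_expmx_le => //; rewrite subr_ge0.
Qed.

Lemma norm2_flow_le t : 0 <= t -> norm2 (flow B u t *m x) <= norm2 x.
Proof.
by move=> t0; rewrite (le_trans (norm2_flow_nonincr (lexx 0) t0))// flow0 mul1mx.
Qed.

Definition speed_bound : R :=
  (\sum_i \sum_l \sum_l' `|B i l l'|) * norm2 x.

Lemma speed_bound_ge0 : 0 <= speed_bound.
Proof.
rewrite mulr_ge0 ?norm2_ge0//; apply: sumr_ge0 => i _.
by apply: sumr_ge0 => l _; apply: sumr_ge0.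
Qed.

(** This bounds how far a trajectory moves in a given time, and it also makes
    trajectories continuous without a study of the switching times. *)
Lemma flow_lipschitz s t : 0 <= s -> s <= t ->
  `|flow B u t *m x - flow B u s *m x| <= (t - s) * speed_bound.
Proof.
move=> s0 st; move: (s0); apply: (@pieces_ind _ _ u (fun s t => 0 <= s ->
  `|flow B u t *m x - flow B u s *m x| <= (t - s) * speed_bound) _ _ s t s0 st) => {s t s0 st}.
  move=> s r t _ sr _ Psr Prt s0.
  rewrite -(subrKA (flow B u r *m x)) (le_trans (ler_normD _ _))//.
  rewrite -(subrKA r t) mulrDl lerD ?Psr//.
  by rewrite Prt// (le_trans s0).
move=> n s t ns st tn s0; rewrite (flow_piece ns st tn) -mulmxA.
have ts0 : 0 <= t - s by rewrite subr_ge0.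
rewrite (le_trans (expmx_displacement _ _ ts0))// ler_wpM2l// ler_pM ?norm2_ge0//.
- by apply: sumr_ge0 => l _; apply: sumr_ge0.
- rewrite [leRHS](bigD1 (mode u n))//= lerDl; apply: sumr_ge0 => j _.
  by apply: sumr_ge0 => l _; apply: sumr_ge0.
- exact: norm2_flow_le.
Qed.

End Flow.

(** * Limit points of a path at infinity *)

Lemma cluster_closed_mem (T : topologicalType) (F : set_system T) (A : set T) q :
  cluster F q -> F A -> closed A -> A q.
Proof. by rewrite clusterE => clq FA cA; apply: cA; exact: clq. Qed.

(** Values of h along g near the limit point are at once close to h q and
    close to l. *)
Lemma cluster_cvg_eq (R : realType) (I : Type) (T : topologicalType)
    (F : set_system I) {FF : Filter F} (g : I -> T) (h : T -> R) (l : R) q :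
  cluster (g x @[x --> F]) q -> continuous h -> h (g x) @[x --> F] --> l -> h q = l.
Proof.
move=> clq ch /cvgrPdist_le hl; apply/eqP; rewrite eq_sym -subr_eq0 -normr_eq0.
rewrite eq_le normr_ge0 andbT; apply/ler_addgt0Pl => e e0; rewrite addr0.
apply: (cluster_closed_mem (A := [set v | `|l - h v| <= e]) clq).
  exact: hl.
apply: (preimage_closed (f := fun v => `|l - h v|) (D := [set a | a <= e])); last exact: closed_le.
move=> v _; apply: (@cvg_norm _ _ _ (nbhs v) _ (fun w => l - h w)).
apply: (@cvgB _ R^o _ (nbhs v)); [exact: cvg_cst|exact: ch].
Qed.

Lemma within_pinfty_proper (R : realType) (S : set R) :
  (forall T, exists2 t, T <= t & S t) -> ProperFilter (within S (+oo : set_system R)).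
Proof.
move=> Sfreq; apply: Build_ProperFilter_ex => A [M [_ MA]].
have [t Mt St] := Sfreq (M + 1).
by exists t; apply: MA => //; rewrite (lt_le_trans _ Mt)// ltrDl.
Qed.

Lemma cluster_at_pinfty_freq (R : realType) (T : topologicalType) (g : R -> T) q (A : set T) M :
  cluster (g t @[t --> +oo]) q -> nbhs q A -> exists2 t, M <= t & A (g t).
Proof.
move=> clq qA.
have [|_ [[t /= Mt <-] At]] := clq (g @` [set t | M <= t]) A _ qA; last by exists t.
exists M; split; first exact: num_real.
by move=> t /= /ltW Mt; exists t.
Qed.

(** If each S i were bounded above by some T i, so would be their union. *)
Lemma frequently_pigeonhole (R : realType) (I : finType) (S : I -> set R) :
  (forall T, exists i t, T <= t /\ S i t) ->
  exists i, forall T, exists2 t, T <= t & S i t.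
Proof.
move=> H; apply: contrapT => /forallNP nS.
have /choice[T hT] : forall i, exists T, forall t, T <= t -> ~ S i t.
  move=> i; have /existsNP[T hT] := nS i; exists T => t Tt St.
  by apply: hT; exists t.
have [i [t [Tt St]]] := H (\sum_i `|T i|).
apply: (hT i t _ St); apply: le_trans Tt; rewrite (le_trans (ler_norm _))//.
by rewrite (bigD1 i)//= lerDl; apply: sumr_ge0.
Qed.

(** Suppose that the limit set splits into two nonempty closed parts. A
    continuous function f equal to 0 on one and to 1 on the other takes values
    below and above 1/2 on every tail of the path, hence the value 1/2 by the
    intermediate value theorem. By compactness the path has a limit point where
    f is 1/2, and it belongs to neither part. *)
Lemma cluster_path_connected (R : realType) (T : pseudoMetricType R)
    (g : R -> T) (K : set T) :
  continuous g -> compact K -> (forall t, K (g t)) ->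
  connected (cluster (g t @[t --> +oo])).
Proof.
have half_lt1 : 2^-1 < 1 :> R by lra.
move=> gc Kc gK C [c Cc] [U oU CU] [D cD CD].
set L := cluster _ in CU CD *.
have cL : closed L by rewrite /L clusterE; apply: closed_bigI => A _; exact: closed_closure.
apply: contrapT => CL.
have [c' Lc' nUc'] : exists2 c', L c' & ~ U c'.
  apply: contrapT => h; apply: CL; rewrite CU; apply/seteqP; split => [v [] // | v Lv].
  by split => //; apply: contrapT => nUv; apply: h; exists v.
have cC : closed C by rewrite CD; exact: closedI.
have cC' : closed (L `&` ~` U) by apply: closedI => //; exact: open_closedC.
have CC' : C `&` (L `&` ~` U) = set0.
  by rewrite CU -subset0 => v [[_ Uv] [_ /(_ Uv)]].
have /(@uniform_separatorP _ R)[f [fc _ f0 f1]] :=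
  (@normal_separatorP R _).1 pseudometric_normal _ _ cC cC' CC'.
have Lc : L c by move: Cc; rewrite CD => -[].
have half_freq M : exists2 t, M <= t & f (g t) = 2^-1.
  have [t1 Mt1 /= ft1] : exists2 t, M <= t & (f @^-1` [set a | a < 2^-1]) (g t).
    apply: (cluster_at_pinfty_freq _ Lc); apply: fc; apply: lt_nbhsl.
    have -> : f c = 0 by apply: f0; exists c.
    by rewrite invr_gt0.
  have [t2 Mt2 /= ft2] : exists2 t, M <= t & (f @^-1` [set a | 2^-1 < a]) (g t).
    apply: (cluster_at_pinfty_freq _ Lc'); apply: fc; apply: lt_nbhsr.
    have -> // : f c' = 1 by apply: f1; exists c' => //; split.
  have fgc D' : {within D', continuous (f \o g)}.
    by apply: continuous_subspaceT => t; apply: continuous_comp; [exact: gc|exact: fc].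
  have [t12|t21] := leP t1 t2.
    have [t] : exists2 t, t \in `[t1, t2] & f (g t) = 2^-1.
      apply: (@IVT _ (f \o g)) => //=.
      by rewrite ge_min (ltW ft1)/= le_max (ltW ft2) orbT.
    by rewrite in_itv/= => /andP[t1t _] ftt; exists t => //; exact: le_trans t1t.
  have [t] : exists2 t, t \in `[t2, t1] & f (g t) = 2^-1.
    apply: (@IVT _ (f \o g)) => //=; first exact: ltW.
    by rewrite ge_min (ltW ft1) orbT/= le_max (ltW ft2).
  by rewrite in_itv/= => /andP[t2t _] ftt; exists t => //; exact: le_trans t2t.
pose F := within [set t | f (g t) = 2^-1] (+oo : set_system R).
have FF : ProperFilter F by exact: within_pinfty_proper.
have [|q [Kq clq]] := Kc (g t @[t --> F]) (fmap_proper_filter g FF).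
  by apply: (@filterE _ F); exact: gK.
have Lq : L q.
  by apply: cvg_cluster clq; apply: cvg_app; exact: cvg_within.
have fq : f q = 2^-1.
  apply: (cluster_cvg_eq clq fc); apply/cvgrPdist_le => e e0.
  by apply: (@filterE _ (+oo : set_system R)) => t /= ->; rewrite subrr normr0 ltW.
have [Uq|nUq] := pselect (U q).
  have : f q = 0 by apply: f0; exists q => //; rewrite CU.
  by rewrite fq => /eqP; rewrite invr_eq0 pnatr_eq0.
have : f q = 1 by apply: f1; exists q => //; split.
by rewrite fq => h; move: half_lt1; rewrite h ltxx.
Qed.

Lemma cV_box_compact (R : realType) d (M : R) :
  compact [set v : 'cV[R]_d | forall i, `|v i 0| <= M].
Proof.
have -> : [set v : 'cV[R]_d | forall i, `|v i 0| <= M] =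
    trmx @` [set v : 'rV[R]_d | forall i, `[-M, M]%classic (v ord0 i)].
  apply/seteqP; split => [v vM|_ [v vM <-] i].
    exists v^T; rewrite ?trmxK// => i /=.
    by rewrite in_itv/= mxE -ler_norml; exact: vM.
  by have := vM i; rewrite /= in_itv/= mxE ler_norml.
apply: continuous_compact; last first.
  by apply: (@rV_compact _ _ (fun=> `[-M, M]%classic)) => _; exact: segment_compact.
apply: continuous_subspaceT => v.
apply: (@cvg_mx_entries _ _ _ _ (nbhs v)) => i j; rewrite mxE.
under eq_fun do rewrite mxE.
exact: coord_continuous.
Qed.

(** * Limit sets of trajectories *)

Section OmegaLimit.
Variables (R : realType) (d p : nat) (B : 'I_p -> 'M[R]_d) (u : input R p).
Hypothesis hB : forall i : 'I_p, negsemidef ((B i)^T + B i).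
Variable x : 'cV[R]_d.

(** At negative times [flow] follows a default piece with no dynamical
    meaning; freezing the solution there makes it continuous on the whole line. *)
Definition trajectory (t : R) : 'cV[R]_d := flow B u (Num.max 0 t) *m x.

Definition omega_limit : set 'cV[R]_d := cluster (trajectory t @[t --> +oo]).

Lemma trajectoryE t : 0 <= t -> trajectory t = flow B u t *m x.
Proof. by move=> t0; rewrite /trajectory max_r. Qed.

Let C := speed_bound B x.

Lemma trajectory_lipschitz s t : `|trajectory t - trajectory s| <= `|t - s| * C.
Proof.
wlog st : s t / s <= t => [H|].
  have [st|/ltW ts] := leP s t; first exact: H.
  by rewrite distrC (distrC t); exact: H.
have ms : 0 <= Num.max 0 s by rewrite le_max lexx.
have mst : Num.max 0 s <= Num.max 0 t.
  by rewrite ge_max le_max lexx/= le_max st orbT.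
rewrite (le_trans (flow_lipschitz u hB x ms mst))// ler_wpM2r ?speed_bound_ge0//.
rewrite ger0_norm ?subr_ge0//.
have [s0|s0] := leP 0 s; have [t0|t0] := leP 0 t; lra.
Qed.

Lemma trajectory_continuous : continuous trajectory.
Proof.
move=> t; apply/cvgrPdist_le => e e0.
have C1 : 0 < C + 1 by rewrite ltr_wpDl// speed_bound_ge0.
have eC : 0 < e / (C + 1) by rewrite divr_gt0.
near=> s; rewrite (le_trans (trajectory_lipschitz _ _))//.
apply: (@le_trans _ _ (e / (C + 1) * (C + 1))); last by rewrite divfK// gt_eqF.
rewrite ler_pM ?speed_bound_ge0//; last by rewrite lerDl.
Unshelve. all: by end_near. Qed.

Lemma norm2_trajectory_nonincr s t : s <= t ->
  norm2 (trajectory t) <= norm2 (trajectory s).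
Proof.
move=> st; apply: norm2_flow_nonincr => //; first by rewrite le_max lexx.
by rewrite ge_max le_max lexx/= le_max st orbT.
Qed.

Let K : set 'cV[R]_d := [set v | forall i, `|v i 0| <= norm2 x].

Lemma trajectory_bounded t : K (trajectory t).
Proof.
move=> i; rewrite (le_trans (entry_le_norm2 _ _))// norm2_flow_le//.
by rewrite le_max lexx.
Qed.

Lemma omega_limit_connected : connected omega_limit.
Proof.
exact: (cluster_path_connected trajectory_continuous (@cV_box_compact _ _ _)
  trajectory_bounded).
Qed.

Lemma norm2_trajectory_cvg : exists2 r : R, 0 <= r &
  norm2 (trajectory t) @[t --> +oo] --> r.
Proof.
pose N := range (fun t => norm2 (trajectory t)).
have Ninf : has_inf N.
  split; first by exists (norm2 (trajectory 0)); exists 0.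
  by exists 0 => _ [t _ <-]; exact: norm2_ge0.
exists (inf N).
  by apply: lb_le_inf; [exact: Ninf.1|move=> _ [t _ <-]; exact: norm2_ge0].
apply/cvgrPdist_le => e e0.
have [_ [T _ <-] NT] := inf_adherent e0 Ninf.
near=> t; have Tt : T <= t by near: t; apply: nbhs_pinfty_ge; exact: num_real.
rewrite distrC ger0_norm ?subr_ge0; last by apply: ge_inf; [exact: Ninf.2|exists t].
by rewrite lerBlDl (le_trans (norm2_trajectory_nonincr Tt))// ltW.
Unshelve. all: by end_near. Qed.

Lemma omega_limit_norm2 r q : norm2 (trajectory t) @[t --> +oo] --> r ->
  omega_limit q -> norm2 q = r.
Proof. by move=> hr oq; exact: (cluster_cvg_eq oq (@norm2_continuous R d) hr). Qed.

(** Along S the solution has a limit point q by compactness. As mode i lasts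
    for time e after each s in S, the norm of exp(tB_i) y(s) tends to r for
    every t in [0, e], so t |-> exp(tB_i) q has constant norm r there. The closed
    set A serves to prescribe where q is found. *)
Lemma omega_limit_isoset (i : 'I_p) (e : R) (S : set R) (A : set 'cV[R]_d) :
  0 < e -> closed A ->
  (forall T, exists2 t, T <= t & S t) ->
  (forall s, S s -> [/\ 0 <= s, A (trajectory s) &
    forall z, s <= z < s + e -> u z = i]) ->
  exists q, [/\ omega_limit q, A q & isoset (B i) q].
Proof.
move=> e0 cA Sfreq SA.
have FF := within_pinfty_proper Sfreq.
set F := within S _ in FF.
have [|q [_ clq]] := @cV_box_compact R d (norm2 x) (trajectory t @[t --> F])
    (fmap_proper_filter trajectory FF).
  by apply: (@filterE _ F); exact: trajectory_bounded.
have oq : omega_limit q by apply: cvg_cluster clq; apply: cvg_app; exact: cvg_within.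
have [r r0 hr] := norm2_trajectory_cvg.
exists q; split => //.
  apply: (cluster_closed_mem clq) => //.
  by apply: (@filterE _ (+oo : set_system R)) => s /= /SA[].
apply: (isoset_of_segment (hB i) e0) => t /andP[t0 te].
rewrite (omega_limit_norm2 hr oq).
apply: (cluster_cvg_eq (h := fun v => norm2 (expmx (t *: B i) *m v)) clq).
  move=> v; apply: (@cvg_comp _ _ _ (mulmx (expmx (t *: B i))) (@norm2 R d) (nbhs v)).
    exact: mulmx_continuous.
  exact: norm2_continuous.
(* For s in S the point exp(tB_i) y(s) is y(s + t), of norm tending to r. *)
have hrt : norm2 (trajectory (s + t)) @[s --> +oo] --> r.
  apply: (@cvg_comp _ _ _ (fun s => s + t)
    (fun s => norm2 (trajectory s)) _ (+oo : set_system R)) => //.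
  apply/cvgryPge => M; near=> s; rewrite -lerBlDr.
  by near: s; apply: nbhs_pinfty_ge; exact: num_real.
apply: cvg_trans (cvg_within_filter S hrt); apply: near_eq_cvg.
apply: (@filterE _ (+oo : set_system R)) => s /= /SA[s0 _ si].
rewrite !trajectoryE ?addr_ge0// (@flow_constant_mode _ _ _ B u i s (s + t))//.
- by rewrite mulmxA [s + t]addrC addrK.
- by rewrite lerDl.
by move=> z /andP[sz zt]; apply: si; rewrite sz (lt_le_trans zt)// lerD2l.
Unshelve. all: by end_near. Qed.

End OmegaLimit.

(** * Regular inputs *)

(** Negating chaos gives intervals of constancy, of length at least eps, whose
    bounds may be open or closed. Keeping only the middle half, starting
    at a + eps / 4, makes the bounds irrelevant. *)
Lemma nonchaotic_constant_segments (R : realType) (p : nat) (u : input R p)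
    (t : nat -> R) (tau : R) :
  ~ chaotic u -> 0 < tau ->
  (forall k, 0 <= t k) -> t k @[k --> \oo] --> +oo ->
  exists2 e, 0 < e & forall k0 : nat, exists k s i, [/\ (k0 <= k)%N,
    t k <= s <= t k + tau & forall z, s <= z < s + e -> u z = i].
Proof.
move=> nch tau0 t0 tinfty; apply: contrapT => H; apply: nch.
exists tau => //; exists t; split => // eps eps0.
apply: contrapT => H'; apply: H; exists (eps / 2); first by rewrite divr_gt0.
move=> k0; apply: contrapT => H; apply: H'; exists k0 => k k0k b b' a c J Jt ac [i ui].
have inJ z : a < z < c -> J z.
  by move=> /andP[az zc]; rewrite /J/= in_itv/=; case: b b' {J Jt ui} => -[] /=; lra.
apply: H; exists k, (a + eps / 4), i; split => //.
  have := Jt (a + eps / 4); rewrite /= in_itv/=; apply; apply: inJ.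
  by apply/andP; split; lra.
by move=> z /andP[sz zs]; apply/ui/inJ; apply/andP; split; lra.
Qed.

Section RegularInput.
Variables (R : realType) (d p : nat) (B : 'I_p -> 'M[R]_d) (u : input R p).
Hypothesis hB : forall i : 'I_p, negsemidef ((B i)^T + B i).
Variable x : 'cV[R]_d.

(** H(i) yields infinitely many switching times followed by a stay of length
    at least delta in mode i. *)
Lemma omega_limit_meets_isoset i : H_assumption u i ->
  omega_limit B u x `&` isoset (B i) !=set0.
Proof.
move=> [nk [delta [nk_incr delta0 hnk]]].
have nk_ge k : (k <= nk k)%N.
  by elim: k => // k IH; exact: leq_ltn_trans IH (nk_incr _ _ (ltnSn k)).
have [||q [oq _ iq]] :=
    @omega_limit_isoset _ _ _ B u hB x i delta (range (switch u \o nk)) setT delta0 closedT.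
- move=> T; have [n Tn] := switch_unbounded u T.
  exists (switch u (nk n)); last by exists n.
  by rewrite (le_trans (ltW Tn))// switch_le.
- move=> _ [k _ <-]; split => //=; first exact: switch_ge0.
  move=> z /andP[sz zs]; have [<- dk] := hnk k; apply: mode_eq; rewrite sz/=.
  by rewrite (lt_le_trans zs)// -lerBrDl.
- by exists q.
Qed.

(** Near a limit point q away from the V_i the trajectory lingers, by the
    Lipschitz bound, during intervals of fixed length tau; on infinitely many of
    them a nonchaotic input stays in one mode for a fixed time, which creates a
    limit point that is in some V_i and still close to q. *)
Lemma omega_limit_sub_isosets : ~ chaotic u ->
  omega_limit B u x `<=` \bigcup_(i in [set: 'I_p]) isoset (B i).
Proof.
move=> nch q oq; apply: contrapT => qW.
set W := \bigcup_(i in _) _ in qW.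
have cW : closed W.
  by apply: closed_bigcup => [|i _]; [exact: finite_finset|exact: isoset_closed].
have /nbhs_ballP[rho /= rho0 rhoW] : nbhs q (~` W).
  by apply: open_nbhs_nbhs; split => //; exact: closed_openC.
have C0 := speed_bound_ge0 B x; set C := speed_bound B x in C0.
have C1 : 0 < C + 1 by lra.
(* During tau the trajectory moves by at most rho / 4; starting within rho / 4
   of q, it remains within rho / 2. *)
pose tau := rho / 4 / (C + 1).
have tau0 : 0 < tau by rewrite !divr_gt0.
have tauC : tau * C <= rho / 4.
  rewrite -[leRHS](divfK (_ : C + 1 != 0)) ?gt_eqF// ler_wpM2l// ?ltW//.
  by rewrite ltrDl.
have /choice[t ht] : forall k : nat, exists t,
    k%:R <= t /\ `|q - trajectory B u x t| < rho / 4.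
  move=> k; have [|t kt qt] := @cluster_at_pinfty_freq _ _ (trajectory B u x) q
    [set v | `|q - v| < rho / 4] k%:R oq.
    apply/nbhs_ballP; exists (rho / 4) => /=; first by rewrite divr_gt0.
    by move=> v; rewrite -ball_normE.
  by exists t.
have t0 k : 0 <= t k by rewrite (le_trans _ (ht k).1).
have tinfty : t k @[k --> \oo] --> +oo.
  by apply: ger_cvgy (@cvgr_idn R); near=> k; exact: (ht k).1.
have [e e0 he] := nonchaotic_constant_segments nch tau0 t0 tinfty.
pose S i := [set s | [/\ 0 <= s, `|q - trajectory B u x s| <= rho / 2 &
    forall z, s <= z < s + e -> u z = i]].
have [T|i Si] := @frequently_pigeonhole _ _ S.
  have [k [s [i [k0k /andP[ts st] ui]]]] := he (Num.trunc T).+1.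
  exists i, s; split.
    rewrite (le_trans _ ts)// (le_trans _ (ht k).1)//.
    by rewrite (le_trans (ltW (truncnS_gt T)))// ler_nat.
  split => //; first exact: le_trans ts.
  rewrite -(subrKA (trajectory B u x (t k))) (le_trans (ler_normD _ _))//.
  rewrite (_ : rho / 2 = rho / 4 + rho / 4); last by lra.
  apply: lerD; first exact: ltW (ht k).2.
  rewrite (le_trans (trajectory_lipschitz u hB x _ _))// (le_trans _ tauC)//.
  by rewrite ler_wpM2r// distrC ger0_norm ?subr_ge0// lerBlDl.
have [|q' [_ qq' iq']] := @omega_limit_isoset _ _ _ B u hB x i e (S i)
    [set v | `|q - v| <= rho / 2] e0 (@closed_closed_ball_ _ 'cV[R]_d q (rho / 2)) Si.
- by move=> s [].
- apply: (rhoW q'); last by exists i.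
  rewrite -ball_normE/=; apply: le_lt_trans qq' _; lra.
Unshelve. all: by end_near. Qed.

Lemma trajectory_cvg0
    (hV : forall r : R, 0 < r ->
      let E := (\bigcup_(i in [set: 'I_p]) isoset (B i)) `&` euclid_sphere r in
      forall x : 'cV[R]_d, E x ->
        ~ (forall i : 'I_p, connected_component E x `&` isoset (B i) !=set0))
    (hu : regular_input u) :
  norm2 (trajectory B u x t) @[t --> +oo] --> 0.
Proof.
have [nch hH] := hu.
have [r r0 hr] := norm2_trajectory_cvg u hB x.
have [r_gt0|r_le0] := ltP 0 r; last by move: hr; rewrite (le_anti (_ : r <= 0 <= r)) ?r_le0.
exfalso; have i0 := u 0.
have [q [oq iq]] := omega_limit_meets_isoset (hH i0).
have oE : omega_limit B u x `<=`
    (\bigcup_(i in [set: 'I_p]) isoset (B i)) `&` euclid_sphere r.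
  move=> v ov; split; first exact: omega_limit_sub_isosets.
  exact: omega_limit_norm2 ov.
apply: (hV r r_gt0 q (oE q oq)) => i.
have [v [ov iv]] := omega_limit_meets_isoset (hH i).
exists v; split => //.
by apply: (connected_component_max oq oE) ov; exact: omega_limit_connected.
Qed.

End RegularInput.

(** * Asymptotic stability *)

(** Asymptotic stability makes the Gram matrix of the flow tend to 0, so 0 is
    an admissible value and the default is not taken; uniqueness of limits then
    gives S S = 0. *)
Lemma limit_sqrt_eq0 (R : realType) (d p : nat) (B : 'I_p -> 'M[R]_d) (u : input R p) :
  asymptotically_stable B u -> limit_sqrt B u = 0.
Proof.
move=> hs.
have flow_cvg0 : flow B u t @[t --> +oo] --> (0 : 'M[R]_d).
  apply: cvg_mx_entries => i j.
  have := cvg_entry (F := +oo) (i := i) (j := 0) (hs (delta_mx j 0)).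
  by rewrite !mxE; under eq_fun do rewrite -colE mxE; apply.
have gram_cvg0 : (flow B u t)^T *m flow B u t @[t --> +oo] -->
      (0 : 'M[R]_d) *m (0 : 'M[R]_d).
  apply: cvg_mulmx => //; apply: cvg_mx_entries => i j; rewrite mxE.
  under eq_fun do rewrite mxE.
  by have := cvg_entry (F := +oo) (i := j) (j := i) flow_cvg0; rewrite mxE; apply.
have [S_sym _ S_cvg] : [set S : 'M[R]_d | [/\ S^T = S, possemidef S &
    (flow B u t)^T *m flow B u t @[t --> +oo] --> S *m S]] (limit_sqrt B u).
  apply: xgetPex; exists 0; split => //; first by rewrite trmx0.
  by move=> v; rewrite mulmx0 mul0mx mxE.
have SS0 : limit_sqrt B u *m limit_sqrt B u = 0.
  rewrite -(cvg_lim (@norm_hausdorff _ _) S_cvg).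
  by rewrite (cvg_lim (@norm_hausdorff _ _) gram_cvg0) mulmx0.
apply/matrixP => i j; rewrite [RHS]mxE.
have : limit_sqrt B u *m delta_mx j 0 = 0 :> 'cV[R]_d.
  apply: norm2_eq0; rewrite norm2E trmx_mul S_sym mulmxA.
  rewrite -(mulmxA _ (limit_sqrt B u) (limit_sqrt B u)) SS0.
  by rewrite mulmx0 mul0mx mxE sqrtr0.
by rewrite -colE => /colP/(_ i); rewrite !mxE.
Qed.

Theorem theorem3 (R : realType) (d p : nat) (B : 'I_p -> 'M[R]_d)
    (hB : forall i : 'I_p, negsemidef ((B i)^T + B i))
    (hV : forall r : R, 0 < r ->
      let E := (\bigcup_(i in [set: 'I_p]) isoset (B i)) `&` euclid_sphere r in
      forall x : 'cV[R]_d, E x ->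
        ~ (forall i : 'I_p, connected_component E x `&` isoset (B i) !=set0))
    (u : input R p) (hu : regular_input u) :
  limit_sqrt B u = 0 /\ asymptotically_stable B u.
Proof.
suff hs : asymptotically_stable B u by split => //; exact: limit_sqrt_eq0.
move=> x; have h0 := trajectory_cvg0 hB x hV hu.
apply: cvg_mx_entries => i j; rewrite mxE (ord1 j).
apply/cvgrPdist_le => e e0; move/cvgrPdist_le : h0 => /(_ e e0) h0.
near=> t; rewrite sub0r normrN -trajectoryE.
  rewrite (le_trans (entry_le_norm2 _ _))//.
  have : `|0 - norm2 (trajectory B u x t)| <= e by near: t.
  by rewrite sub0r normrN ger0_norm// norm2_ge0.
by near: t; apply: nbhs_pinfty_ge; exact: num_real.
Unshelve. all: by end_near. Qed.
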